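(* Let $\pi$ and $\varpi$ be non-zero polynomial divided difference operators, in the variables $(x,y)$ and $(y,z)$ respectively, that satisfy the cubic braid relation $\pi\varpi\pi=\varpi\pi\varpi$, and assume that $\widetilde Q_0=0$. Then one of the following three cases holds. (1) $\pi f=\varpi f=r(y)f$ for a univariate polynomial $r\neq 0$. (2) The field $K$ contains $\zeta$, and for some constants $a\neq 0$ and $b$ we have $\varpi f=a(y+b)f$, and $\pi f$ is given (for all $f$) by one of the four expressions - $a(x+b)\big[(\zeta x+\overline\zeta y+b)\partial f+\overline\zeta f\big]$; - $a(x+b)\big[(\overline\zeta x+\zeta y+b)\partial f+\zeta f\big]$; - $a(y+b)(\zeta x+\overline\zeta y+b)\partial f+a\big(x+\overline\zeta y+(1+\overline\zeta)b\big)f$; - $a(y+b)(\overline\zeta x+\zeta y+b)\partial f+a\big(x+\zeta y+(1+\zeta)b\big)f$. (3) $\varpi$ is a multiple $\mu\operatorname{Id}$ of the identity operator ($\mu$ a constant), and there exist two polynomials $\varphi$ and $\psi$ in $x$ and $y$ such that $\partial(\varphi\psi)=\mu$ and $\pi f=\varphi\,\partial(\psi f)$ for all $f$.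
   Context: $K$ is a field of arbitrary characteristic over which all polynomials are defined; possible extra parameters are regarded as elements of $K$, so ''constant'' means an element of $K$. The operators act on functions $f$ of $x,y,z$ (and possibly other variables), concretely on polynomials over $K$. The operator $s$ interchanges $x$ and $y$, and $\sigma$ interchanges $y$ and $z$; $\partial f=\frac{f-sf}{x-y}$ and $\delta f=\frac{f-\sigma f}{y-z}$. A polynomial divided difference operator in the variables $(x,y)$ is an operator $\pi f=\partial(P(x,y)f)+Q(x,y)\partial f+R(x,y)f+S(x,y)sf$ with two-variable polynomials $P,Q,R,S$; one in the variables $(y,z)$ is $\varpi f=\delta(\widetilde P(y,z)f)+\widetilde Q(y,z)\delta f+\widetilde R(y,z)f+\widetilde S(y,z)\sigma f$. The polynomial $\widetilde Q_0(u,v)=\widetilde P(v,u)+\widetilde Q(u,v)-(u-v)\widetilde S(u,v)$ depends only on $\varpi$, not on the presentation. $\zeta$ denotes a root of $\zeta^2-\zeta+1=0$ and $\overline\zeta=1-\zeta=1/\zeta$ is the other root of that polynomial. *)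

(* Defs.v *)
From HB Require Import structures.
From mathcomp Require Import all_boot all_order all_fingroup all_algebra.
From mathcomp Require Import mpoly ring.

Set Implicit Arguments.
Unset Strict Implicit.
Unset Printing Implicit Defensive.

Import GRing.Theory.
Local Open Scope ring_scope.

(* The operators act on {mpoly K[n]} with n arbitrary. A variable is given by
   its index: x : 'I_n stands for the polynomial 'X_x. *)

Section DividedDifferences.
Variables (K : fieldType) (n : nat).
Implicit Types (x y : 'I_n) (f g : {mpoly K[n]}) (P Q R S : {mpoly K[2]}).

Definition swapv x y f : {mpoly K[n]} := msym (tperm x y) f.

Lemma swapvX x y k : swapv x y 'X_k = 'X_(tperm x y k).
Proof. by rewrite /swapv /msym mmapX mmap1U. Qed.

Lemma ddiff_subproof x y f :
  exists g, ('X_x - 'X_y) * g == f - swapv x y f.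
Proof.
pose D f := exists g, ('X_x - 'X_y) * g == f - swapv x y f.
have D1 : D 1 by exists 0; rewrite mulr0 /swapv msym1 subrr.
have DM p q : D p -> D q -> D (p * q).
  case=> [gp /eqP hp] [gq /eqP hq]; exists (gp * q + swapv x y p * gq).
  rewrite mulrDr mulrA hp mulrCA hq /swapv msymM mulrBl mulrBr.
  by rewrite addrA subrK.
have DX k : D 'X_k.
  rewrite /D swapvX; have [->|->|_ _] := tpermP x y k.
  - by exists 1; rewrite mulr1.
  - by exists (-1); rewrite mulrN1 opprB.
  - by exists 0; rewrite mulr0 subrr.
have {D1 DM DX} DXm m : D 'X_[m].
  rewrite mpolyXE_id; apply: (big_ind D) => // i _.
  by elim: (m i) => [|e IHe]; rewrite ?expr0 // exprS; apply: DM.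
suff : D f by [].
elim/mpolyind: f => [|c m p _ _ [gp /eqP hp]].
  by exists 0; rewrite mulr0 /swapv msym0 subrr.
have [gm /eqP hm] := DXm m; exists (c *: gm + gp); apply/eqP.
rewrite mulrDr -scalerAr hm hp /swapv msymD msymZ scalerBr opprD.
by rewrite addrACA.
Qed.

(* For x != y the choice is unique, as {mpoly K[n]} is an integral domain; for
   x = y the value is junk. *)
Definition ddiff x y f : {mpoly K[n]} := xchoose (ddiff_subproof x y f).

Lemma ddiffE x y f : ('X_x - 'X_y) * ddiff x y f = f - swapv x y f.
Proof. exact/eqP/(xchooseP (ddiff_subproof x y f)). Qed.

Lemma mpolyX_sub_neq0 x y : x != y -> 'X_x - 'X_y != 0 :> {mpoly K[n]}.
Proof.
move=> nxy; apply/eqP => /(congr1 (mcoeff U_(x))) /eqP.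
by rewrite mcoeffB !mcoeffXU eqxx (eq_sym y) (negPf nxy) mcoeff0 subr0 oner_eq0.
Qed.

Lemma ddiff_unique x y f g :
  x != y -> ('X_x - 'X_y) * g = f - swapv x y f -> ddiff x y f = g.
Proof.
move=> /mpolyX_sub_neq0 nz h; apply: (mulfI nz).
by rewrite h ddiffE.
Qed.

Definition at2 P x y : {mpoly K[n]} := P \mPo [tuple 'X_x; 'X_y].

Definition at1 (r : {poly K}) y : {mpoly K[n]} :=
  (map_poly (@mpolyC n K) r).['X_y].

Definition pddo x y P Q R S f : {mpoly K[n]} :=
  ddiff x y (at2 P x y * f) + at2 Q x y * ddiff x y f
  + at2 R x y * f + at2 S x y * swapv x y f.

End DividedDifferences.

(* P(v,u) + Q(u,v) - (u - v) S(u,v) *)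
Definition pddoQ0 (K : fieldType) (P Q S : {mpoly K[2]}) : {mpoly K[2]} :=
  let u : 'I_2 := ord0 in let v : 'I_2 := ord_max in
  at2 P v u + Q - ('X_u - 'X_v) * S.

(* Q0 is the coefficient of the divided difference once the operator is
   rewritten as f |-> Q0 * ddiff f + R0 * f. *)
Lemma pddoE (K : fieldType) (n : nat) (x y : 'I_n) (P Q R S : {mpoly K[2]})
    (f : {mpoly K[n]}) : x != y ->
  pddo x y P Q R S f = at2 (pddoQ0 P Q S) x y * ddiff x y f
    + (ddiff x y (at2 P x y) + at2 R x y + at2 S x y) * f.
Proof.
move=> nxy; have sw : at2 (at2 P ord_max ord0) x y = swapv x y (at2 P x y).
  rewrite /at2 /swapv (comp_mpolyE P) [in RHS](comp_mpolyE P) !raddf_sum /=.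
  apply: eq_bigr => m _; rewrite comp_mpolyZ msymZ; congr (_ *: _).
  rewrite !rmorph_prod; apply: eq_bigr => i _; rewrite !rmorphXn; congr (_ ^+ _).
  rewrite !(tnth_nth 0); case: i => [[|[|//]] ?] /=.
    by rewrite comp_mpolyXU -/(swapv _ _ _) swapvX tpermL.
  by rewrite comp_mpolyXU -/(swapv _ _ _) swapvX tpermR.
apply: (mulfI (mpolyX_sub_neq0 K nxy)); rewrite /pddo.
have -> : at2 (pddoQ0 P Q S) x y =
    swapv x y (at2 P x y) + at2 Q x y - ('X_x - 'X_y) * at2 S x y.
  rewrite -sw /pddoQ0 [LHS]rmorphB rmorphD rmorphM rmorphB /=.
  by rewrite !comp_mpolyXU.
have -> : swapv x y f = f - ('X_x - 'X_y) * ddiff x y f.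
  by rewrite ddiffE opprB addrCA subrr addr0.
have -> : ddiff x y (at2 P x y * f) =
    ddiff x y (at2 P x y) * f + swapv x y (at2 P x y) * ddiff x y f.
  apply: ddiff_unique => //; rewrite mulrDr mulrA ddiffE mulrCA ddiffE.
  by rewrite /swapv msymM mulrBl mulrBr addrA subrK.
by congr (_ * _); ring.
Qed.

(* Main.v *)
(** Writing [t = x - y] and [pi f = A ddiff f + B f], and putting [a = A + t B], one has
    [t pi f = a f - A (s f)], while [varpi] is multiplication by a polynomial [C(y,z)].
    Comparing the coefficients of [f] and [s f] in the braid relation gives
    [a^2 C - A sA sC = t a C^2] and [A (a C - sa sC) = t A C sC].
    If [A = 0] this forces [B = C].  Otherwise the second equation bounds the degree
    of [C] in [z], so [C = c(y)].  If [c] is a constant [mu], the equations become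
    [a - sa = mu t] and [a sa = A sA]; since K[x,y] is factorial, the latter
    means [a = phi psi], [A = phi (s psi)] up to a sign, which is absorbed by moving
    a factor [t] from [phi] to [psi].  If [c] is not constant, then
    [a (c(x) - c(y)) = t c(x)^2], so [c = k (X + b)] is affine, [a = k (x+b)^2], and
    [A sA] is [k^2 (x+b) (y+b)] times a quadratic form, whose
    splitting into [l sl] with [l] linear yields the root [zeta]. *)
Require Import Defs.
From Stdlib Require Import Classical.
From HB Require Import structures.
From mathcomp Require Import all_boot all_order all_fingroup all_algebra.
From mathcomp Require Import mpoly ring zify.
Set Implicit Arguments.
Unset Strict Implicit.
Unset Printing Implicit Defensive.
Import GRing.Theory.
Local Open Scope ring_scope.

(** * Divisibility in K[x,y] *)

Definition divides (R : comRingType) (a b : R) := exists c, b = a * c.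

Lemma divides_add (R : comRingType) (a b c : R) :
  divides a b -> divides a (c - b) -> divides a c.
Proof.
by move=> [u ->] [v /eqP]; rewrite subr_eq => /eqP ->; exists (v + u); rewrite mulrDr.
Qed.

Lemma divides_sub (R : comRingType) (a b c : R) :
  divides a b -> divides a c -> divides a (c - b).
Proof. by move=> [u ->] [v ->]; exists (v - u); rewrite mulrBr. Qed.

Lemma divides_mulr (R : comRingType) (a b c : R) : divides a b -> divides a (b * c).
Proof. by move=> [u ->]; exists (u * c); rewrite mulrA. Qed.

Lemma divides_mull (R : comRingType) (a b c : R) : divides a b -> divides a (c * b).
Proof. by rewrite mulrC; apply: divides_mulr. Qed.

(** * Gauss's lemma and Euclid's lemma in K[x][y] *)

Section Gauss.
Variable K : fieldType.
Implicit Types (l c d : {poly K}) (p q r : {poly {poly K}}).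

(** The content is a unit: phrased through divisors, without choosing a gcd of the coefficients. *)
Definition primitive p := forall l, divides l%:P p -> size l = 1%N.

Lemma primitive_neq0 p : primitive p -> p != 0.
Proof.
move=> pP; apply/eqP => p0; have := pP 0; rewrite size_poly0 => H.
by have // : 0%N = 1%N by apply: H; exists 0; rewrite p0 mulr0.
Qed.

Lemma divides_lead l p :
  l %| lead_coef p -> divides l%:P ((lead_coef p)%:P * 'X^((size p).-1)).
Proof.
by case/dvdpP=> c ->; apply: divides_mulr; exists c%:P; rewrite -rmorphM mulrC.
Qed.

Lemma size_sub_lead p : p != 0 ->
  (size (p - (lead_coef p)%:P * 'X^((size p).-1))%R < size p)%N.
Proof.
move=> p0; have sp : (0 < size p)%N by rewrite size_poly_gt0.
rewrite -[ltnRHS](prednK sp) ltnS; apply/leq_sizeP => j hj.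
rewrite coefB coefCM coefXn; case: eqVneq => [->|nj]; first by rewrite mulr1 subrr.
by rewrite mulr0 subr0 nth_default // -(prednK sp) ltn_neqAle eq_sym nj.
Qed.

(** The hypothesis on [l] is the dichotomy satisfied by primes of K[x]. Such an [l] divides one of
    the two leading coefficients; removing that leading term preserves divisibility of the product,
    and induction applies. *)
Lemma divides_prime l p q : l != 0 -> (forall c, l %| c \/ coprimep l c) ->
  divides l%:P (p * q) -> divides l%:P p \/ divides l%:P q.
Proof.
move=> l0 lP; have [k] := ubnP (size p + size q)%N.
elim: k p q => // k IHk p q; rewrite ltnS => lek dpq.
have [->|p0] := eqVneq p 0; first by left; exists 0; rewrite mulr0.
have [->|q0] := eqVneq q 0; first by right; exists 0; rewrite mulr0.
have : l %| lead_coef p * lead_coef q.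
  by case: dpq => c; rewrite -lead_coefM => ->; rewrite lead_coefM lead_coefC dvdp_mulr.
case: (lP (lead_coef p)) => [lp _|cop].
  have := divides_lead lp; set m := _ * _ => dm.
  have [||h|] := IHk (p - m) q; last by right.
  - by apply: leq_trans lek; rewrite ltn_add2r size_sub_lead.
  - by rewrite mulrBl; apply: divides_sub => //; apply: divides_mulr.
  - by left; apply: divides_add dm h.
rewrite Gauss_dvdpr // => lq.
have := divides_lead lq; set m := _ * _ => dm.
have [|||h] := IHk p (q - m); last 2 first; [by left| |..].
- by right; apply: divides_add dm h.
- by apply: leq_trans lek; rewrite ltn_add2l size_sub_lead.
- by rewrite mulrBr; apply: divides_sub => //; apply: divides_mull.
Qed.

(** Induction on the size of [l]: a splitting of [l] is cancelled factor by factor, and an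
    unsplittable [l] falls under [divides_prime], where it can divide the primitive [p] only as a
    unit. *)
Lemma primitive_cancel l p q :
  l != 0 -> primitive p -> divides l%:P (p * q) -> divides l%:P q.
Proof.
have [k] := ubnP (size l); elim: k l q => // k IHk l q; rewrite ltnS => lek l0 pP dpq.
have [[l1 [l2 [e s1 s2]]]|nred] :=
    classic (exists l1 l2, [/\ l = l1 * l2, (size l1 < size l)%N & (size l2 < size l)%N]).
  move: l0; rewrite e mulf_eq0 negb_or => /andP[l10 l20].
  have [q1 e1] : divides l1%:P q.
    apply: IHk => //; first exact: leq_trans lek.
    by case: dpq => c ->; exists (l2%:P * c); rewrite e rmorphM mulrA.
  have [q2 e2] : divides l2%:P q1.
    apply: IHk => //; first exact: leq_trans lek.
    case: dpq => c ec; exists c; apply: (@mulfI _ l1%:P); first by rewrite polyC_eq0.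
    by rewrite mulrCA -e1 ec e rmorphM mulrA.
  by exists q2; rewrite e1 e2 rmorphM mulrA.
case: (@divides_prime l p q) => // [c|/pP s1]; last first.
  move/eqP/size_poly1P: s1 => [u u0 ->]; exists ((u^-1)%:P%:P * q).
  by rewrite mulrA -!rmorphM mulfV // mul1r.
(* If [l] is unsplittable, a non-constant gcd with [c] cannot be a proper factor, so it is
   associated to [l], which then divides [c]. *)
have [|ncop] := boolP (coprimep l c); [by right | left].
have g0 : gcdp l c != 0 by rewrite gcdp_eq0 (negPf l0).
have /dvdpP[w ew] := dvdp_gcdl l c.
have w0 : w != 0 by apply: contraNneq l0 => w0; rewrite ew w0 mul0r.
have sg : (1 < size (gcdp l c))%N.
  by rewrite ltn_neqAle eq_sym -coprimep_def ncop size_poly_gt0.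
have sl : (size l).+1 = (size w + size (gcdp l c))%N.
  by rewrite [in LHS]ew size_mul // prednK // addn_gt0 size_poly_gt0 w0.
have [ltl|gel] := ltnP (size (gcdp l c)) (size l).
  by case: nred; exists w, (gcdp l c); split=> //; lia.
have /dvdp_size_eqp := dvdp_gcdl l c.
rewrite eqn_leq gel dvdp_leq ?dvdp_gcdl // => /esym.
by rewrite eqp_sym => /eqp_dvdl ->; exact: dvdp_gcdr.
Qed.

(* [Pdiv.Idomain.dvdp] on [{poly {poly K}}] is pseudo-divisibility: it allows a nonzero
   factor of [{poly K}] in front of the dividend. *)
Lemma primitive_dvdp p q : primitive p -> Pdiv.Idomain.dvdp p q -> divides p q.
Proof.
move=> pP /Pdiv.Idomain.dvdpP[[c r] /= c0 e].
have [|r' er] := @primitive_cancel c p r c0 pP.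
  by exists q; rewrite mulrC -e -mul_polyC.
exists r'; apply: (@mulfI _ c%:P); first by rewrite polyC_eq0.
by rewrite mul_polyC e er mulrCA mulrC mulrA.
Qed.

(** Each non-unit factor extracted lowers the degree of the leading coefficient, so extraction
    terminates. *)
Lemma primitive_part p : p != 0 -> exists c q, p = c%:P * q /\ primitive q.
Proof.
have [k] := ubnP (size (lead_coef p)); elim: k p => // k IHk p; rewrite ltnS => lek p0.
have [|npP] := classic (primitive p); first by exists 1, p; rewrite mul1r.
have [l h] := not_all_ex_not _ _ npP; have [[m e] /eqP sl] := imply_to_and _ _ h.
move: (p0); rewrite e mulf_eq0 negb_or polyC_eq0 => /andP[l0 m0].
have [|c [q [em qP]]] := IHk m _ m0; last by exists (l * c), q; rewrite em rmorphM mulrA.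
apply: leq_trans lek; rewrite e lead_coefM lead_coefC size_mul ?lead_coef_eq0 //.
have : (1 < size l)%N by rewrite ltn_neqAle eq_sym sl size_poly_gt0.
by case: (size l) => [|[|s]] // _; rewrite ltnS leq_addl.
Qed.

(** The primitive part [p1] of [p] divides [r] by pseudo-divisibility; the content [c] of [p]
    divides the quotient because it is coprime to the content [d] of [q]. *)
Lemma Euclid_poly2 p q r : p != 0 -> q != 0 ->
  (forall h, divides h p -> divides h q -> exists2 c : K, c != 0 & h = c%:P%:P) ->
  divides p (q * r) -> divides p r.
Proof.
move=> p0 q0 cop [m em].
have [c [p1 [ep p1P]]] := primitive_part p0.
have [d [q1 [eqd q1P]]] := primitive_part q0.
have c0 : c != 0 by apply: contraNneq p0; rewrite ep => ->; rewrite polyC0 mul0r.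
have cop1 : Pdiv.Idomain.coprimep p1 q1.
  have g0 : Pdiv.Idomain.gcdp p1 q1 != 0.
    by rewrite Pdiv.Idomain.gcdp_eq0 negb_and primitive_neq0.
  (* The pseudo-gcd may carry a spurious factor from K[x]; its primitive part [h] genuinely divides
     both polynomials, hence is constant. *)
  have [k [h [eh hP]]] := primitive_part g0.
  have k0 : k != 0 by apply: contraNneq g0; rewrite eh => ->; rewrite polyC0 mul0r.
  have hd w : Pdiv.Idomain.dvdp (Pdiv.Idomain.gcdp p1 q1) w -> divides h w.
    move=> gw; apply: primitive_dvdp => //; apply: Pdiv.Idomain.dvdp_trans gw.
    by rewrite eh Pdiv.Idomain.dvdp_mull.
  have [||u u0 hu] := cop h.
  - by rewrite ep; apply: divides_mull; apply: hd; apply: Pdiv.Idomain.dvdp_gcdl.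
  - by rewrite eqd; apply: divides_mull; apply: hd; apply: Pdiv.Idomain.dvdp_gcdr.
  by rewrite Pdiv.Idomain.coprimep_def eh hu -rmorphM size_polyC mulf_neq0 // polyC_eq0.
have cop2 : coprimep c d.
  apply/Pdiv.Idomain.coprimepP => g /dvdpP[c' ec] /dvdpP[d' ed].
  have [||u u0 /polyC_inj ->] := cop g%:P; last by rewrite -alg_polyC; apply/eqp_scale.
  - by rewrite ep ec; exists (c'%:P * p1); rewrite rmorphM /=; ring.
  - by rewrite eqd ed; exists (d'%:P * q1); rewrite rmorphM /=; ring.
have [r' er] : divides p1 r.
  apply: primitive_dvdp => //; rewrite -(Pdiv.Idomain.Gauss_dvdpr _ cop1).
  have d0 : d != 0 by apply: contraNneq q0; rewrite eqd => ->; rewrite polyC0 mul0r.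
  rewrite -(Pdiv.Idomain.dvdpZr _ _ d0) -mul_polyC mulrA -eqd em ep.
  by apply/Pdiv.Idomain.dvdp_mulr/Pdiv.Idomain.dvdp_mull/Pdiv.Idomain.dvdpp.
(* Coprimality of [c] and [d] is applied coefficientwise to [r']; the premise comes from cancelling
   [p1] and then the primitive [q1]. *)
suff [r'' er''] : divides c%:P (d%:P * r').
  have [r3 e3] : divides c%:P r'.
    exists (map_poly (fun s => s %/ c) r').
    apply/polyP => i; rewrite coefCM coef_map_id0 ?div0p //= mulrC divpK //.
    rewrite -(Gauss_dvdpr _ cop2); have := congr1 (fun s : {poly {poly K}} => s`_i) er''.
    by rewrite /= !coefCM => ->; exact: dvdp_mulr.
  by exists r3; rewrite er e3 ep; ring.
apply: (@primitive_cancel c q1) => //; exists m.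
apply: (mulfI (primitive_neq0 p1P)); transitivity (q * r); first by rewrite eqd er; ring.
by rewrite em ep; ring.
Qed.
End Gauss.

(** * Ring morphisms on multivariate polynomials *)

Section MpolyMorphisms.
Variable K : fieldType.

Lemma mpoly_ring_ind n (P : {mpoly K[n]} -> Prop) :
  (forall c, P c%:MP) -> (forall i, P 'X_i) ->
  (forall p q, P p -> P q -> P (p + q)) ->
  (forall p q, P p -> P q -> P (p * q)) -> forall p, P p.
Proof.
move=> PC PX PD PM; elim/mpolyind => [|c m p _ _ Pp]; first by rewrite -mpolyC0.
apply: (PD) => //; rewrite -mul_mpolyC; apply: (PM) => //; rewrite mpolyXE_id.
apply: (big_ind P) => [||i _]; [by rewrite -mpolyC1|exact: PM|].
elim: (m i) => [|e IHe]; first by rewrite expr0 -mpolyC1.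
by rewrite exprS; apply: PM.
Qed.

(** Reduces the later identities between substitutions and swaps to a check on generators. *)
Lemma mpoly_rmorph_ext n (T : comRingType) (f g : {rmorphism {mpoly K[n]} -> T}) :
  (forall c, f c%:MP = g c%:MP) -> (forall i, f 'X_i = g 'X_i) -> f =1 g.
Proof.
move=> hC hX; elim/mpoly_ring_ind => // p q hp hq; first by rewrite !rmorphD hp hq.
by rewrite !rmorphM hp hq.
Qed.

Lemma poly_rmorph_ext (R T : comNzRingType) (f g : {rmorphism {poly R} -> T}) :
  (forall c, f c%:P = g c%:P) -> f 'X = g 'X -> f =1 g.
Proof.
move=> hC hX; elim/poly_ind => [|p c IHp]; first by rewrite !rmorph0.
by rewrite !rmorphD !rmorphM IHp hC hX.
Qed.

(** Factor theorem: ['X_i] and [h] agree modulo their difference, hence so do [p] and its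
    substituted form. *)
Lemma divides_sub_subst n (i : 'I_n) (h p : {mpoly K[n]}) :
  divides ('X_i - h) (p - (p \mPo [tuple (if j == i then h else 'X_j) | j < n])).
Proof.
set s := mktuple _; elim/mpoly_ring_ind: p => [c|j|p q [p' hp] [q' hq]|p q [p' hp] [q' hq]].
- by exists 0; rewrite comp_mpolyC subrr mulr0.
- rewrite comp_mpolyXU -tnth_nth tnth_mktuple; case: eqP => [->|_].
    by exists 1; rewrite mulr1.
  by exists 0; rewrite subrr mulr0.
- by exists (p' + q'); rewrite rmorphD opprD addrACA mulrDr -hp -hq.
- exists (p' * q + (p \mPo s) * q').
  by rewrite rmorphM mulrDr mulrA -hp mulrCA -hq; ring.
Qed.

Section Swap.
Variables (n : nat) (x y : 'I_n).
Implicit Types (f g : {mpoly K[n]}) (P Q : {mpoly K[2]}) (c : K).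
(* [swap_morph], [at2_morph] and [at1_morph] are unary aliases, so that the operators
   can carry a ring morphism structure. *)
Definition swap_morph : {mpoly K[n]} -> {mpoly K[n]} := swapv x y.
HB.instance Definition _ := GRing.RMorphism.copy swap_morph (msym (tperm x y)).

Lemma swapvE f : swapv x y f = swap_morph f. Proof. by []. Qed.

Lemma swapvM f g : swapv x y (f * g) = swapv x y f * swapv x y g.
Proof. exact: (rmorphM swap_morph). Qed.
Lemma swapvD f g : swapv x y (f + g) = swapv x y f + swapv x y g.
Proof. exact: (rmorphD swap_morph). Qed.
Lemma swapvB f g : swapv x y (f - g) = swapv x y f - swapv x y g.
Proof. exact: (rmorphB swap_morph). Qed.
Lemma swapv0 : swapv x y (0 : {mpoly K[n]}) = 0.
Proof. exact: (rmorph0 swap_morph). Qed.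
Lemma swapv1 : swapv x y (1 : {mpoly K[n]}) = 1.
Proof. exact: (rmorph1 swap_morph). Qed.
Lemma swapvC c : swapv x y (c%:MP : {mpoly K[n]}) = c%:MP.
Proof. by rewrite /swapv -alg_mpolyC msymZ msym1. Qed.
Lemma swapvK : involutive (swapv (K := K) x y).
Proof.
by move=> f; rewrite /swapv -msymMm -{2}(tpermV x y) mulgV msym1m.
Qed.
Lemma swapvXl : swapv x y ('X_x : {mpoly K[n]}) = 'X_y.
Proof. by rewrite swapvX tpermL. Qed.
Lemma swapvXr : swapv x y ('X_y : {mpoly K[n]}) = 'X_x.
Proof. by rewrite swapvX tpermR. Qed.
Lemma swapv_eq0 f : (swapv x y f == 0) = (f == 0).
Proof. by apply/eqP/eqP => [h|->]; [rewrite -[f]swapvK h|]; rewrite swapv0. Qed.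

Definition at2_morph (P : {mpoly K[2]}) : {mpoly K[n]} := at2 P x y.
HB.instance Definition _ := GRing.RMorphism.copy at2_morph
  (@comp_mpoly 2 K n [tuple 'X_x; 'X_y]).

Lemma at2M P Q : at2 (P * Q) x y = at2 P x y * at2 Q x y :> {mpoly K[n]}.
Proof. exact: (rmorphM at2_morph). Qed.
Lemma at2D P Q : at2 (P + Q) x y = at2 P x y + at2 Q x y :> {mpoly K[n]}.
Proof. exact: (rmorphD at2_morph). Qed.
Lemma at2B P Q : at2 (P - Q) x y = at2 P x y - at2 Q x y :> {mpoly K[n]}.
Proof. exact: (rmorphB at2_morph). Qed.
Lemma at2C c : at2 c%:MP x y = c%:MP :> {mpoly K[n]}.
Proof. exact: comp_mpolyC. Qed.
Lemma at2_0 : at2 0 x y = 0 :> {mpoly K[n]}.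
Proof. exact: (rmorph0 at2_morph). Qed.
Lemma at2X0 : at2 'X_ord0 x y = 'X_x :> {mpoly K[n]}.
Proof. by rewrite /at2 comp_mpolyXU. Qed.
Lemma at2X1 : at2 'X_ord_max x y = 'X_y :> {mpoly K[n]}.
Proof. by rewrite /at2 comp_mpolyXU. Qed.

Lemma ord2_cases (P : 'I_2 -> Prop) : P ord0 -> P ord_max -> forall i, P i.
Proof.
move=> P0 P1 i; case: (unliftP ord0 i) => [j ->|-> //].
by rewrite [j]ord1 (_ : lift _ _ = ord_max) //; apply/val_inj.
Qed.

End Swap.

Local Notation i0 := (ord0 : 'I_2).
Local Notation i1 := (ord_max : 'I_2).

(** * Transfer between K[x,y] and the ambient polynomial ring *)

Section Pullback.
Variables (n : nat) (x y : 'I_n).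
Hypothesis nxy : x != y.
Implicit Types (f g : {mpoly K[n]}) (P Q : {mpoly K[2]}).

Lemma at2_swapv P : at2 (swapv i0 i1 P) x y = swapv x y (at2 P x y).
Proof.
apply: (@mpoly_rmorph_ext _ _ (at2_morph x y \o swap_morph i0 i1)
  (swap_morph x y \o at2_morph x y)) => [c|] /=.
  by rewrite -!swapvE swapvC /at2_morph at2C swapvC.
rewrite /at2_morph; apply: ord2_cases; rewrite -!swapvE ?at2X0 ?at2X1.
  by rewrite !swapvXl at2X1.
by rewrite !swapvXr at2X0.
Qed.

(** A left inverse sends ['X_x] and ['X_y] back to the two variables and all others to zero. *)
Lemma at2_inj : injective (fun P => at2 P x y).
Proof.
pose h i : {mpoly K[2]} := if i == x then 'X_i0 else if i == y then 'X_i1 else 0.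
pose s := [tuple h i | i < n].
apply: (@can_inj _ _ _ (comp_mpoly s)) => P.
apply: (@mpoly_rmorph_ext _ _ (comp_mpoly s \o at2_morph x y) idfun) => [c|] /=.
  by rewrite [at2_morph _ _ _]at2C comp_mpolyC.
rewrite /at2_morph; apply: ord2_cases; rewrite ?at2X0 ?at2X1 comp_mpolyXU -tnth_nth.
  by rewrite tnth_mktuple /h eqxx.
by rewrite tnth_mktuple /h eq_sym (negPf nxy) eqxx.
Qed.

Lemma at2_ddiff P : at2 (ddiff i0 i1 P) x y = ddiff x y (at2 P x y).
Proof.
apply/esym/ddiff_unique => //.
by rewrite -at2_swapv -at2B -ddiffE at2M at2B at2X0 at2X1.
Qed.

End Pullback.

Section Univariate.
Variable n : nat.
Implicit Types (r : {poly K}) (y : 'I_n).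

Definition at1_morph y r : {mpoly K[n]} := at1 r y.
HB.instance Definition _ y := GRing.RMorphism.copy (at1_morph y)
  (horner_eval ('X_y : {mpoly K[n]}) \o map_poly (@mpolyC n K)).

Lemma at1C c y : at1 c%:P y = c%:MP :> {mpoly K[n]}.
Proof. by rewrite /at1 map_polyC hornerC. Qed.
Lemma at1X y : at1 'X y = 'X_y :> {mpoly K[n]}.
Proof. by rewrite /at1 map_polyX hornerX. Qed.
Lemma at1_0 y : at1 0 y = 0 :> {mpoly K[n]}.
Proof. exact: (rmorph0 (at1_morph y)). Qed.

Lemma swapv_at1 r x y : swapv x y (at1 r y : {mpoly K[n]}) = at1 r x.
Proof.
apply: (@poly_rmorph_ext _ _ (swap_morph x y \o at1_morph y) (at1_morph x)) => [c|] /=.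
  by rewrite /at1_morph !at1C -swapvE swapvC.
by rewrite /at1_morph !at1X -swapvE swapvXr.
Qed.

End Univariate.

Lemma at2_at1 n (x y : 'I_n) r : at2 (at1 r i0) x y = at1 r x :> {mpoly K[n]}.
Proof.
apply: (@poly_rmorph_ext _ _ (at2_morph x y \o at1_morph i0) (at1_morph x)) => [c|] /=.
  by rewrite /at1_morph !at1C [LHS]at2C.
by rewrite /at1_morph !at1X [LHS]at2X0.
Qed.

Lemma at2_at1r n (x y : 'I_n) r : at2 (at1 r i1) x y = at1 r y :> {mpoly K[n]}.
Proof.
apply: (@poly_rmorph_ext _ _ (at2_morph x y \o at1_morph i1) (at1_morph y)) => [c|] /=.
  by rewrite /at1_morph !at1C [LHS]at2C.
by rewrite /at1_morph !at1X [LHS]at2X1.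
Qed.

(** * Degree in a single variable *)

Section Isolate.
Variables (n : nat) (z : 'I_n).

(* Reads a polynomial as univariate in ['X_z]. *)
Definition isolate : {mpoly K[n]} -> {poly {mpoly K[n]}} :=
  mmap (polyC \o @mpolyC n K) (fun i => if i == z then 'X else ('X_i)%:P).
HB.instance Definition _ := GRing.RMorphism.on isolate.

Lemma isolateC c : isolate c%:MP = c%:MP%:P. Proof. exact: mmapC. Qed.
Lemma isolateX i : isolate 'X_i = if i == z then 'X else ('X_i)%:P.
Proof. by rewrite /isolate mmapX mmap1U. Qed.

Lemma isolateM f g : isolate (f * g) = isolate f * isolate g.
Proof. exact: rmorphM. Qed.
Lemma isolateB f g : isolate (f - g) = isolate f - isolate g.
Proof. exact: rmorphB. Qed.

Lemma isolate_at2 x y P : x != z -> y != z -> isolate (at2 P x y) = (at2 P x y)%:P.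
Proof.
move=> xz yz; apply: (@mpoly_rmorph_ext _ _ (isolate \o at2_morph x y)
  (polyC \o at2_morph x y)) => [c|] /=.
  by rewrite [at2_morph _ _ _]at2C isolateC.
rewrite /at2_morph; apply: ord2_cases; rewrite ?at2X0 ?at2X1 isolateX.
  by rewrite (negPf xz).
by rewrite (negPf yz).
Qed.

Lemma isolateK f : (isolate f).['X_z] = f.
Proof.
apply: (@mpoly_rmorph_ext _ _ (horner_eval 'X_z \o isolate) idfun) => [c|i] /=.
  by rewrite isolateC /horner_eval hornerC.
by rewrite isolateX /horner_eval; case: eqP => [->|_]; rewrite ?hornerX ?hornerC.
Qed.

Lemma isolate_swapv x y f : x != z -> y != z ->
  isolate (swapv x y f) = map_poly (swapv x y) (isolate f).
Proof.
move=> xz yz.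
apply: (@mpoly_rmorph_ext _ _ (isolate \o swap_morph x y)
  (map_poly (swap_morph x y) \o isolate)) => [c|i] /=.
  by rewrite -!swapvE swapvC isolateC map_polyC /= -swapvE swapvC.
rewrite -!swapvE swapvX !isolateX; have [->|iz] := eqVneq i z.
  by rewrite tpermD ?eqxx ?map_polyX // eq_sym.
rewrite map_polyC /= -swapvE swapvX.
by case: tpermP => _; rewrite ?(negPf xz) ?(negPf yz) ?(negPf iz).
Qed.

(** The swap fixes ['X_z], so it only acts, injectively, on the coefficients. *)
Lemma size_isolate_swapv x y f : x != z -> y != z ->
  size (isolate (swapv x y f)) = size (isolate f).
Proof.
move=> xz yz; rewrite isolate_swapv // size_map_inj_poly //; last exact: swapv0.
exact: inv_inj (swapvK _ _).
Qed.

(** The witness is P(y,0). *)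
Lemma isolate_at1 y P : y != z ->
  exists r : {poly K}, (isolate (at2 P y z)).[0] = at1 r y.
Proof.
move=> yz; pose h := mmap (@polyC K) (fun i : 'I_2 => if i == i0 then 'X else 0).
exists (h P).
apply: (@mpoly_rmorph_ext _ _ (horner_eval 0 \o (isolate \o at2_morph y z))
  (at1_morph y \o h)) => [c|] /=.
  by rewrite [at2_morph _ _ _]at2C isolateC /horner_eval hornerC /h mmapC [RHS]at1C.
rewrite /at2_morph /horner_eval /h.
apply: ord2_cases; rewrite ?at2X0 ?at2X1 isolateX mmapX mmap1U /=.
  by rewrite (negPf yz) hornerC [RHS]at1X.
by rewrite eqxx hornerX [RHS]at1_0.
Qed.

Lemma isolate_const f g : isolate f = g%:P -> f = (isolate f).[0].
Proof. by move=> e; rewrite -[f in LHS]isolateK e !hornerC. Qed.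

End Isolate.
End MpolyMorphisms.

(** * The functional equations in K[x,y] *)

Section Bivariate.
Variable K : fieldType.
Local Notation i0 := (ord0 : 'I_2).
Local Notation i1 := (ord_max : 'I_2).
Local Notation X := ('X_i0 : {mpoly K[2]}).
Local Notation Y := ('X_i1 : {mpoly K[2]}).
Local Notation "f ^s" := (swapv i0 i1 f) (at level 2, format "f ^s").
Implicit Types (p q r f g h : {mpoly K[2]}).

(** One half of the isomorphism of K[x,y] with K[x][y]; [X] becomes the inner variable. *)
Definition to_poly2 : {mpoly K[2]} -> {poly {poly K}} :=
  mmap (polyC \o @polyC K) (fun i => if i == i0 then 'X%:P else 'X).
HB.instance Definition _ := GRing.RMorphism.on to_poly2.
Definition of_poly2 : {poly {poly K}} -> {mpoly K[2]} :=
  horner_eval Y \o map_poly (at1_morph i0).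
HB.instance Definition _ := GRing.RMorphism.on of_poly2.

Lemma to_poly2C c : to_poly2 c%:MP = c%:P%:P. Proof. exact: mmapC. Qed.
Lemma to_poly2X : to_poly2 X = 'X%:P. Proof. by rewrite /to_poly2 mmapX mmap1U. Qed.
Lemma to_poly2Y : to_poly2 Y = 'X. Proof. by rewrite /to_poly2 mmapX mmap1U. Qed.
Lemma of_poly2C (r : {poly K}) : of_poly2 r%:P = at1 r i0.
Proof. by rewrite /of_poly2 /= map_polyC /horner_eval hornerC. Qed.
Lemma of_poly2X : of_poly2 'X = Y.
Proof. by rewrite /of_poly2 /= map_polyX /horner_eval hornerX. Qed.

Lemma to_poly2K p : of_poly2 (to_poly2 p) = p.
Proof.
apply: (@mpoly_rmorph_ext _ _ _ (of_poly2 \o to_poly2) idfun) => [c|] /=.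
  by rewrite to_poly2C of_poly2C at1C.
by apply: ord2_cases; rewrite ?to_poly2X ?to_poly2Y ?of_poly2C ?of_poly2X ?at1X.
Qed.

Lemma to_poly2_at1 (r : {poly K}) : to_poly2 (at1 r i0) = r%:P.
Proof.
apply: (@poly_rmorph_ext _ _ (to_poly2 \o at1_morph i0) polyC) => [c|] /=.
  by rewrite [at1_morph _ _]at1C to_poly2C.
by rewrite [at1_morph _ _]at1X to_poly2X.
Qed.

Lemma to_poly2_at1r (r : {poly K}) : to_poly2 (at1 r i1) = map_poly polyC r.
Proof.
apply: (@poly_rmorph_ext _ _ (to_poly2 \o at1_morph i1) (map_poly polyC)) => [c|] /=.
  by rewrite [at1_morph _ _]at1C to_poly2C map_polyC.
by rewrite [at1_morph _ _]at1X to_poly2Y map_polyX.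
Qed.

Lemma of_poly2K (p : {poly {poly K}}) : to_poly2 (of_poly2 p) = p.
Proof.
apply: (@poly_rmorph_ext _ _ (to_poly2 \o of_poly2) idfun) => [c|] /=.
  by rewrite of_poly2C to_poly2_at1.
by rewrite of_poly2X to_poly2Y.
Qed.

Lemma Euclid_mpoly2 p q r : p != 0 -> q != 0 ->
  (forall h, divides h p -> divides h q -> exists c : K, h = c%:MP) ->
  divides p (q * r) -> divides p r.
Proof.
have inj := can_inj to_poly2K.
move=> p0 q0 cop [m em].
have [||h [c ec] [d ed]||r' er] := @Euclid_poly2 K (to_poly2 p) (to_poly2 q) (to_poly2 r).
- by rewrite -(rmorph0 to_poly2) inj_eq.
- by rewrite -(rmorph0 to_poly2) inj_eq.
- have [||k hk] := cop (of_poly2 h).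
  + by exists (of_poly2 c); rewrite -rmorphM -ec /= to_poly2K.
  + by exists (of_poly2 d); rewrite -rmorphM -ed /= to_poly2K.
  have eh : h = k%:P%:P by rewrite -[h]of_poly2K hk to_poly2C.
  (* The constant is nonzero because it divides [p]. *)
  exists k => //; apply: contraNneq p0 => k0.
  by rewrite -(inj_eq inj) rmorph0 ec eh k0 !polyC0 mul0r.
- by exists (to_poly2 m); rewrite -!rmorphM em.
by exists (of_poly2 r'); rewrite -[p]to_poly2K -rmorphM -er /= to_poly2K.
Qed.

(** Non-constant common divisors are pulled out one by one, each lowering the total degree of
    [p]. *)
Lemma common_divisor_max p q : p != 0 -> exists g p1 q1,
  [/\ p = g * p1, q = g * q1 &
      forall h, divides h p1 -> divides h q1 -> exists c : K, h = c%:MP].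
Proof.
have [k] := ubnP (msize p); elim: k p q => // k IHk p q; rewrite ltnS => lek p0.
have [cop|ncop] := classic
  (forall h, divides h p -> divides h q -> exists c : K, h = c%:MP).
  by exists 1, p, q; rewrite !mul1r.
have [h nh] := not_all_ex_not _ _ ncop.
have [[p1 ep] nh1] := imply_to_and _ _ nh; have [[q1 eq1] nc] := imply_to_and _ _ nh1.
move: (p0); rewrite ep mulf_eq0 negb_or => /andP[h0 p10].
have [|g [p2 [q2 [ep2 eq2 cop]]]] := IHk p1 q1 _ p10; last first.
  by exists (h * g), p2, q2; rewrite eq1 ep2 eq2 !mulrA.
apply: leq_trans lek; rewrite ep msizeM //.
have : (1 < msize h)%N.
  by rewrite ltnNge; apply/negP => /msize1_polyC hC; apply: nc; exists h@_0.
by case: (msize h) => [|[|s]] // _; rewrite ltnS leq_addl.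
Qed.

Lemma divides_subX p : p \mPo [tuple Y; Y] = 0 -> divides (X - Y) p.
Proof.
move=> p0; have := divides_sub_subst i0 Y p.
set s := mktuple _; suff -> : p \mPo s = 0 by rewrite subr0.
rewrite -p0; congr comp_mpoly; apply: eq_from_tnth.
by apply: ord2_cases; rewrite tnth_mktuple.
Qed.

(** After division by a greatest common divisor [g], the coprime cofactors satisfy
    [a1 * a1^s = A1 * A1^s], so [a1^s] and [A1] agree up to a unit [u] with [u * u^s = 1], that is,
    up to sign. *)
Lemma swap_factor (a A B : {mpoly K[2]}) :
  a != 0 -> a = A + (X - Y) * B -> a * a^s = A * A^s ->
  exists phi psi, a = phi * psi /\ A = phi * psi^s.
Proof.
move=> a0 eaB eaA.
have [g [a1 [A1 [ea eA cop]]]] := common_divisor_max A a0.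
move: (a0); rewrite ea mulf_eq0 negb_or => /andP[g0 a10].
have gs0 : g^s != 0 by rewrite swapv_eq0.
have as0 : a1^s != 0 by rewrite swapv_eq0.
have e1 : a1 * a1^s = A1 * A1^s.
  apply: (mulfI (mulf_neq0 g0 gs0)).
  by move: eaA; rewrite ea eA !swapvM => e; rewrite [LHS]mulrACA e mulrACA.
have A10 : A1 != 0.
  by apply: contraNneq (mulf_neq0 a10 as0); rewrite e1 => ->; rewrite mul0r.
have [||u eu] := @Euclid_mpoly2 A1 a1 a1^s A10 a10.
- by move=> h h1 h2; apply: cop.
- by exists A1^s.
have us : a1 = A1^s * u^s by rewrite -[a1](swapvK i0 i1) eu swapvM.
have uu : u * u^s = 1.
  apply: (mulfI (mulf_neq0 A10 (_ : A1^s != 0))); first by rewrite swapv_eq0.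
  by rewrite mulrACA -eu mulr1 -us mulrC.
(* Total degrees in [u * u^s = 1] force [u] to be constant. *)
have [c uc] : exists c, u = c%:MP.
  exists u@_0; apply: msize1_polyC.
  have u0 : u != 0 by apply/eqP => u0; move/eqP: uu; rewrite u0 mul0r eq_sym oner_eq0.
  have := congr1 (fun p : {mpoly K[2]} => msize p) uu; 
  rewrite /= msizeM ?swapv_eq0 // msize1.
  have : (0 < msize u^s)%N by rewrite lt0n msize_poly_eq0 swapv_eq0.
  have : (0 < msize u)%N by rewrite lt0n msize_poly_eq0.
  move: (msize u) (msize u^s) => m1 m2; lia.
move: eu uu; rewrite {us}uc swapvC -mpolyCM -mpolyC1 => eu /eqP; rewrite mpolyC_eq.
rewrite -expr2 sqrf_eq1 => /orP[] /eqP c1.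
  by exists g, a1; rewrite eu c1 mpolyC1 mulr1.
have eA1 : A1 = - a1^s by rewrite eu c1 mpolyCN mpolyC1 mulrN1 opprK.
(* In characteristic 2 the sign disappears and the same witnesses serve. *)
have [ch2|ch2] := eqVneq (2%:R : K) 0.
  exists g, a1; split; first by [].
  rewrite eA eA1; congr (_ * _).
  apply/eqP; rewrite -subr_eq0 -opprD oppr_eq0 -mulr2n -mulr_natl -mpolyC_nat ch2.
  by rewrite mpolyC0 mul0r.
have two0 : 2%:R != 0 :> {mpoly K[2]}.
  by move: ch2; rewrite -(mpolyC_eq0 2) mpolyC_nat.
(* In the case [A1 = - a1^s], setting [x = y] in [a = A + (x - y) B] shows that
   [x - y] divides [g] or [a1]; the latter would contradict coprimality. *)
pose s := [tuple Y; Y]; pose sY := comp_mpoly s.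
have sYs f : sY f^s = sY f.
  apply: (@mpoly_rmorph_ext _ _ _ (sY \o swap_morph i0 i1) sY) => [c'|] /=.
    by rewrite -swapvE swapvC.
  by apply: ord2_cases; rewrite -swapvE swapvX ?tpermL ?tpermR !comp_mpolyXU.
have : sY g * sY a1 = 0.
  have := congr1 sY eaB; rewrite ea eA eA1 /sY mulrN rmorphD rmorphN !rmorphM rmorphB /=.
  rewrite !comp_mpolyXU subrr mul0r addr0 -!/(sY _) sYs => /eqP.
  rewrite -addr_eq0 -mulr2n -mulr_natl mulf_eq0 => /orP[/eqP two_eq0|/eqP //].
  by case/eqP: two0.
move/eqP; rewrite mulf_eq0 => /orP[] /eqP /divides_subX [w ew].
  exists w, ((X - Y) * a1); rewrite eA eA1 ew swapvM swapvB swapvXl swapvXr.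
  by split; ring.
have [||d ed] := cop (X - Y).
- by exists w.
- by exists w^s; rewrite eA1 ew swapvM swapvB swapvXl swapvXr; ring.
have := congr1 sY ed; rewrite /sY rmorphB /= !comp_mpolyXU subrr comp_mpolyC => d0.
by move: ed; rewrite -d0 => /eqP; rewrite (negPf (mpolyX_sub_neq0 K _)).
Qed.

Lemma msize_swapv p : msize p^s = msize p.
Proof.
have le q : (msize q^s <= msize q)%N.
  rewrite msizeE; apply/bigmax_leqP_seq => m ms _.
  move: ms; rewrite mcoeff_msupp mcoeff_sym -mcoeff_msupp => /msize_mdeg_lt.
  by rewrite mdeg_mperm.
by apply/eqP; rewrite eqn_leq le -{1}[p](swapvK i0 i1) le.
Qed.

Lemma msizeM_leq p q : (msize (p * q) <= (msize p + msize q).-1)%N.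
Proof.
have [->|p0] := eqVneq p 0; first by rewrite mul0r msize0.
have [->|q0] := eqVneq q 0; first by rewrite mulr0 msize0.
by rewrite msizeM.
Qed.

Lemma linear_mpoly2 p : (msize p <= 2)%N ->
  exists k l m : K, p = k%:MP * X + l%:MP * Y + m%:MP.
Proof.
move=> sp; exists p@_U_(i0), p@_U_(i1), p@_0; apply/mpolyP => m.
rewrite !mcoeffD !mcoeffCM !mcoeffX mcoeffC.
case em: (mdeg m) => [|[|d]].
- move/eqP: em; rewrite mdeg_eq0 => /eqP ->.
  have h i : U_(i)%MM == 0%MM :> 'X_{1..2} = false by rewrite -mdeg_eq0 mdeg1.
  by rewrite !h eqxx !mulr0 mulr1 !add0r.
- move/eqP: em => /mdeg1P[i /eqP ->].
  rewrite -[_ == 0%MM]mdeg_eq0 mdeg1 mulr0 addr0 !eq_mnm1.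
  by move: i; apply: ord2_cases; rewrite /= ?mulr1 ?mulr0 ?addr0 ?add0r.
- have -> : p@_m = 0 by apply/memN_msupp_eq0/msize_mdeg_ge; rewrite em (leq_trans sp).
  have h i : (U_(i)%MM == m) = false by apply/eqP => e; move: em; rewrite -e mdeg1.
  by rewrite !h -[m == 0%MM]mdeg_eq0 em !mulr0 !addr0.
Qed.

Section Specialize.
Variables (b : K) (w : {poly K}).
(* [x + b] becomes ['X] and [y + b] becomes [w]. *)
Definition specialize : {mpoly K[2]} -> {poly K} :=
  mmap (@polyC K) (fun i : 'I_2 => if i == i0 then 'X - b%:P else w - b%:P).
HB.instance Definition _ := GRing.RMorphism.on specialize.
Lemma specializeC d : specialize d%:MP = d%:P. Proof. exact: mmapC. Qed.
Lemma specializeX : specialize (X + b%:MP) = 'X.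
Proof. by rewrite rmorphD /= specializeC /specialize mmapX mmap1U subrK. Qed.
Lemma specializeY : specialize (Y + b%:MP) = w.
Proof. by rewrite rmorphD /= specializeC /specialize mmapX mmap1U subrK. Qed.
End Specialize.

(** * The functional equations for a non-constant univariate [c] *)

Section CaseTwo.
Variables (c : {poly K}) (a A B : {mpoly K[2]}).
Hypothesis sc : (1 < size c)%N.
Local Notation u := (at1 c i0 : {mpoly K[2]}).
Local Notation v := (at1 c i1 : {mpoly K[2]}).
Hypothesis A0 : A != 0.
Hypothesis eaB : a = A + (X - Y) * B.
Hypothesis eI : a ^+ 2 * v - A * A^s * u = (X - Y) * a * v ^+ 2.
Hypothesis eII : a * v - a^s * u = (X - Y) * u * v.

Let t0 : X - Y != 0. Proof. exact: mpolyX_sub_neq0. Qed.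
Let c0 : c != 0. Proof. by rewrite -size_poly_gt0 ltnW. Qed.

(** In K[x][y], [u] is a constant while [v] has positive degree in y. *)
Let suv : size (to_poly2 (u - v)) = size c.
Proof.
have sm : size (map_poly polyC c) = size c.
  by rewrite size_map_inj_poly //; exact: polyC_inj.
rewrite rmorphB /= to_poly2_at1 to_poly2_at1r -size_polyN opprB size_polyDl ?sm //.
by rewrite size_polyN size_polyC c0.
Qed.

Let uv : u - v != 0.
Proof.
apply/eqP => uv; move: suv; rewrite uv rmorph0 size_poly0 => s0.
by move: sc; rewrite -s0.
Qed.

Let us : u^s = v. Proof. by rewrite -[v](swapvK i0 i1) swapv_at1. Qed.
Let vs : v^s = u. Proof. exact: swapv_at1. Qed.

Let v0 : v != 0.
Proof.
by apply: contraNneq uv => h; rewrite -vs h swapv0 subrr.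
Qed.

Let a0 : a != 0.
Proof.
apply/eqP => a0; move/eqP: eII; rewrite a0 swapv0 !mul0r subrr eq_sym !mulf_eq0.
by rewrite (negPf t0) (negPf v0) -(swapv_eq0 i0 i1) us (negPf v0).
Qed.

(** The product [A * A^s] is eliminated between [eI] and its image under the swap, then [a^s] by
    means of [eII]. *)
Let eauv : a * (u - v) = (X - Y) * u ^+ 2.
Proof.
have eIs : a^s ^+ 2 * u - A^s * A * v = (Y - X) * a^s * u ^+ 2.
  by have := congr1 (swapv i0 i1) eI;
    rewrite swapvB !expr2 !swapvM swapvB swapvXl swapvXr swapvK us vs.
apply: (mulfI v0); rewrite -[RHS]subr0.
(* Given [eII], the combination [v * eI - u * eIs] is divisible by [(X - Y) * (u - v)]. *)
have e : a * v ^+ 2 = a^s * u ^+ 2.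
  apply: (mulfI (mulf_neq0 t0 uv)); apply/eqP; rewrite -subr_eq0; apply/eqP.
  transitivity ((X - Y) * u * v * (a * v + a^s * u) - ((X - Y) * a * v ^+ 2) * v
    + ((Y - X) * a^s * u ^+ 2) * u); first by ring.
  by rewrite -eI -eIs -eII; ring.
have -> : 0 = (a^s * u ^+ 2 - a * v ^+ 2) by rewrite e subrr.
transitivity (a * v * u - a * v ^+ 2); first by ring.
have -> : a * v = (X - Y) * u * v + a^s * u by rewrite -eII; ring.
by rewrite e; ring.
Qed.

(** The right side of [eauv] has degree 1 in y, and on the left [u - v] alone contributes the degree
    of [c]. *)
Let size_c : size c = 2%N.
Proof.
have inj0 p : (to_poly2 p == 0) = (p == 0).
  by rewrite -(rmorph0 to_poly2) (inj_eq (can_inj to_poly2K)).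
have := congr1 (size \o to_poly2) eauv.
have -> : (size \o to_poly2) ((X - Y) * u ^+ 2) = 2%N.
  rewrite /= rmorphM rmorphB rmorphXn /= to_poly2_at1 to_poly2X to_poly2Y.
  rewrite -[_ - _]opprB mulNr size_polyN -rmorphXn size_mul ?polyXsubC_eq0 //=.
    by rewrite size_XsubC size_polyC expf_neq0.
  by rewrite polyC_eq0 expf_neq0.
have sa : (0 < size (to_poly2 a))%N by rewrite size_poly_gt0 inj0.
rewrite /= rmorphM size_mul ?inj0 //= [X in (_ + X)%N]suv.
move: sc sa; move: (size c) => m; move: (size _) => d; lia.
Qed.

Let affine : exists k b : K, [/\ k != 0, c = k *: ('X + b%:P),
   u = k%:MP * (X + b%:MP) & v = k%:MP * (Y + b%:MP)].
Proof.
have k0 : c`_1 != 0 by move: c0; rewrite -lead_coef_eq0 lead_coefE size_c.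
have ec : c = c`_1 *: ('X + (c`_0 / c`_1)%:P).
  apply/polyP => i; rewrite coefZ coefD coefX coefC.
  case: i => [|[|i]] /=; rewrite ?add0r ?addr0 ?mulr1 ?mulr0 //.
    by rewrite mulrCA divff ?mulr1.
  by rewrite nth_default // size_c.
exists c`_1, (c`_0 / c`_1); split=> //; rewrite {1}ec -mul_polyC.
  rewrite [LHS](rmorphM (at1_morph i0)) (rmorphD (at1_morph i0)) /= /at1_morph.
  by rewrite !at1C at1X.
rewrite [LHS](rmorphM (at1_morph i1)) (rmorphD (at1_morph i1)) /= /at1_morph.
by rewrite !at1C at1X.
Qed.

Lemma case_two : exists k b zeta : K,
  [/\ k != 0, c = k *: ('X + b%:P), zeta ^+ 2 - zeta + 1 = 0,
   a = k%:MP * (X + b%:MP) ^+ 2 &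
   A = k%:MP * (X + b%:MP) * (zeta%:MP * (X + b%:MP) + (1 - zeta)%:MP * (Y + b%:MP)) \/
   A = k%:MP * (Y + b%:MP) * (zeta%:MP * (X + b%:MP) + (1 - zeta)%:MP * (Y + b%:MP))].
Proof.
have [k [b [k0 ec eu ev]]] := affine; exists k, b.
have kM0 : k%:MP != 0 :> {mpoly K[2]} by rewrite mpolyC_eq0.
have ea : a = k%:MP * (X + b%:MP) ^+ 2.
  apply: (mulfI (mulf_neq0 t0 kM0)); transitivity (a * (u - v)).
    by rewrite eu ev; ring.
  by rewrite eauv eu; ring.
set x' := X + b%:MP in eu ea *; set y' := Y + b%:MP in ev *.
have x'0 : x' != 0 by apply: contraNneq a0 => h; rewrite ea h expr2 !mul0r mulr0.
have xs : x'^s = y' by rewrite swapvD swapvC swapvXl.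
have ys : y'^s = x' by rewrite -xs swapvK.
have y'0 : y' != 0 by rewrite -xs swapv_eq0.
(* This is [eI] with the values of [a], [u], [v] inserted, divided by [u]. *)
have eAA : A * A^s = k%:MP ^+ 2 * x' * y' * (x' ^+ 2 - x' * y' + y' ^+ 2).
  apply: (mulfI (mulf_neq0 kM0 x'0)).
  transitivity (a ^+ 2 * v - (X - Y) * a * v ^+ 2).
    by rewrite -eI eu; ring.
  by rewrite ea ev (_ : X - Y = x' - y'); [ring | rewrite /x' /y'; ring].
(* Setting x = -b kills [A * A^s], so [x'] divides [A] or [A^s]; in the latter case [y'] divides
   [A]. *)
have [A1 [eA eAA1]] : exists A1 : {mpoly K[2]}, (A = x' * A1 \/ A = y' * A1) /\
    A1 * A1^s = k%:MP ^+ 2 * (x' ^+ 2 - x' * y' + y' ^+ 2).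
  have dv p : p \mPo [tuple - b%:MP; Y] = 0 -> divides x' p.
    move=> p0; have := divides_sub_subst i0 (- b%:MP) p.
    set s := mktuple _; suff -> : p \mPo s = 0 by rewrite subr0 opprK.
    rewrite -p0; congr comp_mpoly; apply: eq_from_tnth.
    by apply: ord2_cases; rewrite tnth_mktuple.
  have x'y' := mulf_neq0 x'0 y'0.
  have : (A * A^s) \mPo [tuple - b%:MP; Y] = 0.
    have x's : x' \mPo [tuple - b%:MP; Y] = 0.
      by rewrite /x' rmorphD /= comp_mpolyXU comp_mpolyC /= addNr.
    by rewrite eAA !rmorphM /= x's mulr0 !mul0r.
  rewrite rmorphM => /eqP; rewrite mulf_eq0 => /orP[] /eqP /dv [A1 eA1].
    exists A1; split; first by left.
    apply: (mulfI x'y'); transitivity (A * A^s); first by rewrite eA1 swapvM xs; ring.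
    by rewrite eAA; ring.
  have eA : A = y' * A1^s by rewrite -[A](swapvK i0 i1) eA1 swapvM xs.
  exists A1^s; split; first by right.
  apply: (mulfI x'y'); transitivity (A * A^s); first by rewrite eA swapvM ys; ring.
  by rewrite eAA; ring.
(* The swap preserves total degree, so [A1] has half the degree of a product of degree at most 2. *)
have [|al [be [ga eA1]]] := @linear_mpoly2 A1.
  have A10 : A1 != 0 by apply: contraNneq A0 => A10; case: eA => ->; rewrite A10 mulr0.
  have : (msize (A1 * A1^s) <= 3)%N.
    have affX i : (msize ('X_i + b%:MP : {mpoly K[2]}) <= 2)%N.
      apply: leq_trans (mmeasureD_le _ _ _) _.
      by rewrite mmeasureX mmeasureC /= mdeg1; case: (b != 0).
    have affXX i j : (msize (('X_i + b%:MP) * ('X_j + b%:MP) : {mpoly K[2]}) <= 3)%N.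
      apply: leq_trans (msizeM_leq _ _) _; rewrite -subn1 leq_subLR.
      exact: leq_add (affX i) (affX j).
    rewrite eAA1; apply: leq_trans (msizeM_leq _ _) _.
    rewrite -rmorphXn /= mmeasureC expf_neq0 //= add0n.
    have leD p q : (msize p <= 3)%N -> (msize q <= 3)%N -> (msize (p + q) <= 3)%N.
      by move=> hp hq; apply: leq_trans (mmeasureD_le _ _ _) _; rewrite geq_max hp hq.
    by rewrite !expr2; apply: (leD); [apply: leD; rewrite ?mmeasureN|]; apply: affXX.
  rewrite msizeM ?swapv_eq0 // msize_swapv.
  by case: (msize A1) => [|[|[|m]]] //; rewrite !addSn !addnS.
pose g' := ga - al * b - be * b.
have eA1' : A1 = al%:MP * x' + be%:MP * y' + g'%:MP.
  by rewrite eA1 /x' /y' /g' !mpolyCB !mpolyCM; ring.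
have eA1s : A1^s = al%:MP * y' + be%:MP * x' + g'%:MP.
  by rewrite eA1' !swapvD !swapvM !swapvC xs ys.
have Ex w : specialize b w x' = 'X by exact: specializeX.
have Ey w : specialize b w y' = w by exact: specializeY.
have xy : X - Y = x' - y' by rewrite /x' /y'; ring.
clearbody x' y' g'.
(* Setting [y' = 0]. The constant term then yields [g' = 0], and evaluation at 1 yields
   [al * be = k ^+ 2]. *)
have e1 : (al%:P * 'X + g'%:P) * (be%:P * 'X + g'%:P) = k%:P ^+ 2 * 'X ^+ 2.
  have := congr1 (specialize b 0) eAA1; rewrite eA1s {1}eA1'.
  rewrite !(rmorphM, rmorphD, rmorphB, rmorphN, rmorphXn) /= !specializeC.
  by rewrite !Ex !Ey !mulr0 expr0n /= subr0 !addr0 add0r.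
have g0 : g' = 0.
  have := congr1 (fun p : {poly K} => p.[0]) e1.
  by rewrite !hornerE /= mulr0 => /eqP; rewrite mulf_eq0 orbb => /eqP.
have ab : al * be = k ^+ 2.
  have := congr1 (fun p : {poly K} => p.[1]) e1.
  by rewrite g0 !hornerE /= ?mulr1 ?addr0.
(* On the diagonal [x' = y'], [eaB] says that [a] and [A] coincide. *)
have abk : al + be = k.
  have := congr1 (fun p => (specialize b 'X p).[1]) eaB.
  rewrite ea xy.
  case: eA => ->; rewrite eA1' g0 /= !(rmorphM, rmorphD, rmorphB, rmorphN, rmorphXn) /=;
    rewrite !specializeC !Ex !Ey subrr mul0r addr0;
    by rewrite !hornerE /= !mulr1.
(* Both [al / k] and [be / k] are roots of the quadratic: their sum and their product are 1. *)
exists (al / k).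
have ez : 1 - al / k = be / k.
  by rewrite -{1}(divff k0) -mulrBl -abk; congr (_ / _); ring.
have eA1k : A1 = k%:MP * ((al / k)%:MP * x' + (be / k)%:MP * y').
  rewrite eA1' g0 mpolyC0 addr0 mulrDr !mulrA -!mpolyCM.
  by rewrite ![k * _]mulrC !divfK.
split=> //; last by rewrite ez; case: eA => ->; [left|right]; rewrite eA1k; ring.
transitivity (1 - (al / k) * (1 - al / k)); first by ring.
by rewrite ez mulrACA ab -invfM -expr2 divff ?subrr // expf_neq0.
Qed.
End CaseTwo.
End Bivariate.

(** * The braid relation *)

(** Multiplied by [t] twice, the braid relation reads [f * L = s f * M] for all [f]. Taking [f = 1]
    gives [L = M], and then [f = 'X_x] gives [t * L = 0]. The factor [A] stays in the second
    equation since [A] may vanish. *)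
Lemma braid_coefficients (K : fieldType) (n : nat) (x y : 'I_n)
    (A B C : {mpoly K[n]}) (pi : {mpoly K[n]} -> {mpoly K[n]})
    (t := 'X_x - 'X_y) (a := A + t * B) (s := @swapv K n x y) :
  x != y -> (forall f, pi f = A * ddiff x y f + B * f) ->
  (forall f, pi (C * pi f) = C * pi (C * f)) ->
  a ^+ 2 * C - A * s A * s C = t * a * C ^+ 2 /\
  A * (a * C - s a * s C) = A * (t * C * s C).
Proof.
move=> nxy piE braid.
have tpi f : t * pi f = a * f - A * s f.
  rewrite piE; transitivity (A * (t * ddiff x y f) + t * B * f); first by ring.
  by rewrite ddiffE /a /s; ring.
have st : s t = - t by rewrite /s swapvB swapvXl swapvXr opprB.
have tspi f : t * s (pi f) = s A * f - s a * s f.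
  transitivity (- s (t * pi f)); first by rewrite [s (t * _)]swapvM -/s st; ring.
  by rewrite tpi [s (_ - _)]swapvB !swapvM [swapv x y (swapv _ _ _)]swapvK -/s; ring.
pose L := a ^+ 2 * C - A * s A * s C - t * a * C ^+ 2.
pose M := A * (a * C - s a * s C) - A * (t * C * s C).
have key f : f * L = s f * M.
  have : t * (t * pi (C * pi f)) = t * (t * (C * pi (C * f))) by rewrite braid.
  rewrite tpi [t * (C * _)]mulrCA tpi ![s (C * _)]swapvM -/s => e.
  apply/eqP; rewrite -subr_eq0; apply/eqP.
  transitivity (a * C * (a * f - A * s f) - A * s C * (s A * f - s a * s f)
    - t * (C * (a * (C * f) - A * (s C * s f)))); first by rewrite /L /M; ring.
  by rewrite -e -tpi -tspi; ring.
have LM : L = M by have := key 1; rewrite /s swapv1 !mul1r.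
have L0 : L = 0.
  apply: (mulfI (mpolyX_sub_neq0 K nxy)).
  by rewrite mulr0 mulrBl (key 'X_x) /s swapvXl LM subrr.
by split; apply/eqP; rewrite -subr_eq0; apply/eqP => //; rewrite -[LHS]LM.
Qed.

(** Both coefficients are exhibited as images of polynomials in K[x,y], ready for the transfer by
    [at2_inj]. *)
Lemma pddo_split (K : fieldType) (n : nat) (x y : 'I_n) (P Q R S : {mpoly K[2]})
    (f : {mpoly K[n]}) : x != y ->
  pddo x y P Q R S f = at2 (pddoQ0 P Q S) x y * ddiff x y f
    + at2 (ddiff ord0 ord_max P + R + S) x y * f.
Proof. by move=> nxy; rewrite pddoE // !at2D at2_ddiff. Qed.

(** The right side has twice the degree of [p], the left side at most that degree. *)
Lemma size_le1_of_quadratic (R : idomainType) (a b t : R) (p q : {poly R}) :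
  t != 0 -> p != 0 -> size q = size p ->
  a%:P * p - b%:P * q = t%:P * p * q -> (size p <= 1)%N.
Proof.
move=> t0 p0 sq e.
have q0 : q != 0 by rewrite -size_poly_gt0 sq size_poly_gt0.
have : (size (t%:P * p * q)%R <= size p)%N.
  rewrite -e; apply: leq_trans (size_polyD _ _) _; rewrite geq_max size_polyN.
  by rewrite !mul_polyC size_scale_leq -[leqRHS]sq size_scale_leq.
rewrite -mulrA mul_polyC size_scale // size_mul // sq.
move: p0; rewrite -size_poly_gt0; move: (size p) => m; lia.
Qed.

Lemma cancel_cubic (R : idomainType) (t b c : R) : t != 0 -> b != 0 -> c != 0 ->
  (t * b) ^+ 2 * c = t * (t * b) * c ^+ 2 -> b = c.
Proof.
move=> t0 b0 c0 e; apply: (mulfI (mulf_neq0 (mulf_neq0 (mulf_neq0 t0 t0) b0) c0)).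
by transitivity ((t * b) ^+ 2 * c); [|rewrite e]; ring.
Qed.

(** * Case analysis on [A] and on the degree of [r] *)

Theorem proposition25 (K : fieldType) (n : nat) (x y z : 'I_n)
    (nxy : x != y) (nyz : y != z) (nxz : x != z)
    (P Q R S Pt Qt Rt St : {mpoly K[2]})
    (pi varpi : {mpoly K[n]} -> {mpoly K[n]})
    (pi_def : forall f, pi f = pddo x y P Q R S f)
    (varpi_def : forall f, varpi f = pddo y z Pt Qt Rt St f)
    (pi_neq0 : ~ (forall f, pi f = 0))
    (varpi_neq0 : ~ (forall f, varpi f = 0))
    (braid : forall f, pi (varpi (pi f)) = varpi (pi (varpi f)))
    (Qt0_eq0 : pddoQ0 Pt Qt St = 0) :
  (exists2 r : {poly K}, r != 0 &
     forall f, pi f = at1 r y * f /\ varpi f = at1 r y * f)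
  \/
  (exists zeta : K, zeta ^+ 2 - zeta + 1 = 0 /\
   exists a b : K, [/\ a != 0,
     forall f, varpi f = a *: (('X_y + b%:MP) * f) &
     let zetab := 1 - zeta in
     [\/ forall f, pi f =
           a *: (('X_x + b%:MP) *
                 ((zeta *: 'X_x + zetab *: 'X_y + b%:MP) * ddiff x y f
                  + zetab *: f)),
         forall f, pi f =
           a *: (('X_x + b%:MP) *
                 ((zetab *: 'X_x + zeta *: 'X_y + b%:MP) * ddiff x y f
                  + zeta *: f)),
         forall f, pi f =
           a *: (('X_y + b%:MP) * (zeta *: 'X_x + zetab *: 'X_y + b%:MP)
                 * ddiff x y f)
           + a *: (('X_x + zetab *: 'X_y + ((1 + zetab) * b)%:MP) * f) |
         forall f, pi f =
           a *: (('X_y + b%:MP) * (zetab *: 'X_x + zeta *: 'X_y + b%:MP)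
                 * ddiff x y f)
           + a *: (('X_x + zeta *: 'X_y + ((1 + zeta) * b)%:MP) * f)]])
  \/
  (exists mu : K, (forall f, varpi f = mu *: f) /\
   exists phi psi : {mpoly K[2]},
     ddiff x y (at2 (phi * psi) x y) = mu%:MP /\
     forall f, pi f = at2 phi x y * ddiff x y (at2 psi x y * f)).
Proof.
pose i0 : 'I_2 := ord0; pose i1 : 'I_2 := ord_max.
pose A := pddoQ0 P Q S; pose B := ddiff i0 i1 P + R + S.
pose a := A + ('X_i0 - 'X_i1) * B.
pose C : {mpoly K[n]} := at2 (ddiff i0 i1 Pt + Rt + St) y z.
have piE f : pi f = at2 A x y * ddiff x y f + at2 B x y * f.
  by rewrite pi_def pddo_split.
have varpiE f : varpi f = C * f.
  by rewrite varpi_def pddo_split // Qt0_eq0 at2_0 mul0r add0r.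
have C0 : C != 0 by apply/eqP => C0; apply: varpi_neq0 => f; rewrite varpiE C0 mul0r.
have [r er] : exists r, (isolate z C).[0] = at1 r y by exact: isolate_at1.
have eaB : a = A + ('X_i0 - 'X_i1) * B by [].
clearbody C A B a.
have ea : at2 A x y + ('X_x - 'X_y) * at2 B x y = at2 a x y.
  by rewrite eaB at2D at2M at2B at2X0 at2X1.
have [eI eII] : at2 a x y ^+ 2 * C - at2 A x y * at2 (swapv i0 i1 A) x y * swapv x y C
    = ('X_x - 'X_y) * at2 a x y * C ^+ 2 /\
  at2 A x y * (at2 a x y * C - at2 (swapv i0 i1 a) x y * swapv x y C)
    = at2 A x y * (('X_x - 'X_y) * C * swapv x y C).
  have braidC f : pi (C * pi f) = C * pi (C * f) by rewrite -!varpiE braid.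
  by have := braid_coefficients nxy piE braidC; rewrite /= ea !at2_swapv.
have t0 := mpolyX_sub_neq0 K nxy.
have isoat2 (G : {mpoly K[2]}) : isolate z (at2 G x y) = (at2 G x y)%:P.
  exact: isolate_at2.
have tpi f : ('X_x - 'X_y) * pi f = at2 a x y * f - at2 A x y * swapv x y f.
  transitivity (at2 A x y * (('X_x - 'X_y) * ddiff x y f) + ('X_x - 'X_y) * at2 B x y * f).
    by rewrite piE; ring.
  by rewrite ddiffE -ea; ring.
have [A0|A0] := eqVneq A 0.
  left.
  have eA0 : at2 A x y = 0 :> {mpoly K[n]} by rewrite A0 at2_0.
  have piB f : pi f = at2 B x y * f by rewrite piE eA0 mul0r add0r.
  have B0 : at2 B x y != 0 :> {mpoly K[n]}.
    by apply/eqP => B0; apply: pi_neq0 => f; rewrite piB B0 mul0r.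
  have BC : at2 B x y = C.
    move: eI; rewrite -ea eA0 !mul0r subr0 add0r.
    exact: cancel_cubic.
  (* [C], a polynomial in y and z, equals one in x and y, so it is free of z. *)
  have eC : C = at1 r y.
    by rewrite -er -BC isoat2 hornerC.
  exists r; first by apply: contraNneq C0 => r0; rewrite eC r0 at1_0.
  by move=> f; rewrite piB BC varpiE eC.
right.
have A0n : at2 A x y != 0 :> {mpoly K[n]}.
  by apply: contraNneq A0 => h; apply/eqP/(at2_inj nxy); rewrite h at2_0.
move/(mulfI A0n): eII => eII.
(* In [eII], read in ['X_z], only [C] and its swap involve z, and they have equal degree. *)
have eC : C = at1 r y.
  rewrite -er.
  suff: (size (isolate z C) <= 1)%N by move/size1_polyC/isolate_const.
  have isoC0 : isolate z C != 0.
    by apply: contraNneq C0 => h; rewrite -(isolateK z C) h horner0.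
  have isoXY : isolate z ('X_x - 'X_y : {mpoly K[n]}) = ('X_x - 'X_y)%:P.
    by have := isoat2 ('X_i0 - 'X_i1); rewrite at2B at2X0 at2X1.
  apply: (@size_le1_of_quadratic _ (at2 a x y) (at2 (swapv i0 i1 a) x y)
    _ _ _ t0 isoC0 (size_isolate_swapv C nxz nyz)).
  by have := congr1 (isolate z) eII; rewrite isolateB !isolateM isoXY !isoat2.
have sC : swapv x y C = at1 r x by rewrite eC swapv_at1.
have {eII} eII : a * at1 r i1 - swapv i0 i1 a * at1 r i0
    = ('X_i0 - 'X_i1) * at1 r i0 * at1 r i1.
  apply: (at2_inj nxy) => /=.
  by rewrite at2B !at2M at2B !at2_at1 !at2_at1r at2X0 at2X1 -sC -eC eII mulrAC.
have {eI} eI : a ^+ 2 * at1 r i1 - A * swapv i0 i1 A * at1 r i0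
    = ('X_i0 - 'X_i1) * a * at1 r i1 ^+ 2.
  apply: (at2_inj nxy) => /=.
  by rewrite !expr2 at2B !at2M at2B !at2_at1 !at2_at1r at2X0 at2X1 -sC -eC -!expr2 eI.
have [sc|sc] := leqP (size r) 1.
  right; have [mu ec] : exists mu, r = mu%:P by exists r`_0; exact: size1_polyC.
  exists mu; have eCmu : C = mu%:MP by rewrite eC ec at1C.
  split=> [f|]; first by rewrite varpiE eCmu mul_mpolyC.
  have mu0 : mu%:MP != 0 :> {mpoly K[2]}.
    by move: C0; rewrite eCmu !mpolyC_eq0.
  move: eI eII; rewrite ec !at1C => eI eII.
  have das : a - swapv i0 i1 a = ('X_i0 - 'X_i1) * mu%:MP.
    by apply: (mulIf mu0); rewrite mulrBl eII.
  have a0 : a != 0.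
    apply/eqP => a0; move/eqP: das; rewrite a0 swapv0 subrr eq_sym mulf_eq0.
    by rewrite (negPf mu0) (negPf (mpolyX_sub_neq0 K _)).
  (* By [das], the term [t * a * mu ^+ 2] of [eI] is [a * (a - a^s) * mu], which leaves
     [a * a^s = A * A^s]. *)
  have [] := @swap_factor K a A B a0 eaB.
    apply: (mulIf mu0); transitivity (a ^+ 2 * mu%:MP - a * (a - swapv i0 i1 a) * mu%:MP).
      by ring.
    transitivity (a ^+ 2 * mu%:MP - ('X_i0 - 'X_i1) * a * mu%:MP ^+ 2).
      by rewrite das; ring.
    by rewrite -eI; ring.
  move=> phi [psi [ephi epsi]]; exists phi, psi; split.
    apply: ddiff_unique => //; rewrite -ephi -at2_swapv -at2B das.
    by rewrite at2M at2B at2X0 at2X1 at2C.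
  move=> f; apply: (mulfI t0); rewrite tpi [in RHS]mulrCA ddiffE swapvM.
  by rewrite ephi epsi !at2M at2_swapv; ring.
left.
have [k [b [zeta [k0 ec ez eak eA]]]] := @case_two K r a A B sc A0 eaB eI eII.
exists zeta; split=> //; exists k, b; split=> //.
  move=> f; rewrite varpiE eC ec -mul_mpolyC -mul_polyC.
  rewrite [at1 _ _](rmorphM (at1_morph y)) (rmorphD (at1_morph y)) /= /at1_morph !at1C at1X.
  by rewrite mulrA.
move=> zetab.
have Zz : zeta%:MP = 1 - zetab%:MP :> {mpoly K[n]} by rewrite mpolyCB mpolyC1; ring.
rewrite -/zetab in eA; clearbody zetab.
have at2x : at2 ('X_i0 + b%:MP) x y = 'X_x + b%:MP by rewrite at2D at2X0 at2C.
have at2y : at2 ('X_i1 + b%:MP) x y = 'X_y + b%:MP by rewrite at2D at2X1 at2C.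
have at2a : at2 a x y = k%:MP * ('X_x + b%:MP) ^+ 2.
  by rewrite eak expr2 !at2M at2C at2x expr2.
have at2l : at2 (zeta%:MP * ('X_i0 + b%:MP) + zetab%:MP * ('X_i1 + b%:MP)) x y
    = zeta%:MP * ('X_x + b%:MP) + zetab%:MP * ('X_y + b%:MP).
  by rewrite at2D !at2M !at2C at2x at2y.
(* The second and fourth expressions are the first and third for the other root, and [zeta] is the
   root that arose from [A]. Replacing [s f] by [f - t * ddiff f] turns the coefficient of [f] into
   [a - A], a multiple of [t]. *)
case: eA => eA; [constructor 1|constructor 3] => f; apply: (mulfI t0).
  rewrite tpi at2a eA !at2M at2C at2x at2l -!mul_mpolyC Zz.
  rewrite (_ : swapv x y f = f - ('X_x - 'X_y) * ddiff x y f); last first.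
    by rewrite ddiffE opprB addrC subrK.
  move: (ddiff x y f) ('X_x) ('X_y) k%:MP b%:MP zetab%:MP => d u v k' b' w; ring.
rewrite tpi at2a eA !at2M at2C at2y at2l -!mul_mpolyC mpolyCM mpolyCD mpolyC1 Zz.
rewrite (_ : swapv x y f = f - ('X_x - 'X_y) * ddiff x y f); last first.
  by rewrite ddiffE opprB addrC subrK.
move: (ddiff x y f) ('X_x) ('X_y) k%:MP b%:MP zetab%:MP => d u v k' b' w; ring.
Qed.
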